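(* Let $r\in\mathbb N$, $r\ge2$, and let $g\in C[0,\infty)$ and $f_\pm\in C[0,\infty)$ satisfy Assumptions 1, 2 and 3 listed in the context. Let $\{a_n^\pm\}_{n=1}^\infty$ and $\{G_\tau^\pm\}_{\tau>0}$ be as follows: $\{a_n^+\}$ and $\{a_n^-\}$ are non-increasing sequences of positive numbers with $\lim_{n\to\infty}a_n^\pm=0$, $a_0^\pm:=\infty$, and for each $n\in\mathbb Z_+$ and $\tau\in[a_{n+1}^\pm,a_n^\pm)$, $G_\tau^\pm\in\Gamma^r_{n,g}[0,\infty)$ is a perfect $g$-spline with exactly $n$ knots and $n+1$ points of oscillation (positively oriented for $G_\tau^+$, negatively oriented for $G_\tau^-$) between $-\tau f_-$ and $\tau f_+$. Then for all $k=1,\ldots,r-1$ and $\delta>0$, $$\omega(W^r_{f_-,f_+,g}[0,\infty),D^k,\delta)=\max\left\{|(G_\delta^+)^{(k)}(0)|,\ |(G_\delta^-)^{(k)}(0)|\right\}.$$ If $|(G_\delta^+)^{(k)}(0)|>|(G_\delta^-)^{(k)}(0)|$, then the supremum in the definition of $\omega(W^r_{f_-,f_+,g}[0,\infty),D^k,\delta)$ is attained on $G_\delta^+$; otherwise it is attained on $G_\delta^-$.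
   Context: Notation: $f(\infty):=\lim_{t\to+\infty}f(t)$; $\mathbb Z_+=\{0,1,2,\ldots\}$. Every occurrence of $\pm$ is read as two statements, one with all upper and one with all lower signs. Auxiliary functions: $g_0:=g$ and $g_k(t):=\int_0^t g_{k-1}(s)\,ds$, $t\ge0$, $k=1,\ldots,r$. Put $A_0:=\int_0^\infty g(t)\,dt$ and, for $k=1,\ldots,r-1$, $$A_k:=\int_0^\infty\Big[\sum_{s=0}^{k-1}\frac{(-1)^{k-s-1}A_s}{(k-s-1)!}t^{k-s-1}+(-1)^kg_k(t)\Big]dt .$$ Put $$P_r(t):=(-1)^r\sum_{s=0}^{r-1}\frac{(-1)^{r-s-1}A_s}{(r-s-1)!}t^{r-s-1}+g_r(t).$$ Assumption 1: $g\in C[0,\infty)$ is positive, non-increasing, and $A_k<\infty$ for $k=0,1,\ldots,r-1$. Assumption 2: $f_+,f_-\in C[0,\infty)$ are non-increasing, positive, and $f_\pm(\infty)>0$. Assumption 3: $\liminf_{t\to\infty}\frac{f_\pm(t)-f_\pm(\infty)}{|P_r(t)|}=0$ (for each of the two functions $f_+$, $f_-$). Norm and class: $\|x\|_{C[0,\infty)}:=\sup_{t\ge0}|x(t)|$ and $\|x\|_{C[0,\infty),f_-,f_+}:=\sup_{t\ge0}\Big|\frac{\max\{x(t),0\}}{f_+(t)}+\frac{\max\{-x(t),0\}}{f_-(t)}\Big|$. $W^r_{f_-,f_+,g}[0,\infty)$ is the set of $x\in C[0,\infty)$ such that $x^{(r-1)}$ exists and is locally absolutely continuous, $\|x\|_{C[0,\infty),f_-,f_+}<\infty$,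 and $|x^{(r)}(t)|\le g(t)$ for almost all $t\ge0$. Modulus of continuity of the $k$-th order differentiation operator: $$\omega(W^r_{f_-,f_+,g}[0,\infty),D^k,\delta):=\sup\left\{\|x^{(k)}\|_{C[0,\infty)}:\ x\in W^r_{f_-,f_+,g}[0,\infty),\ \|x\|_{C[0,\infty),f_-,f_+}\le\delta\right\}.$$ Perfect $g$-splines: $G\in C^{r-1}[0,\infty)$ is a perfect $g$-spline of order $r$ with $n\in\mathbb N$ knots $0<t_1<\ldots<t_n<\infty$ if, with $t_0:=0$, $t_{n+1}:=\infty$, there is $\epsilon\in\{1,-1\}$ such that for each $i=0,\ldots,n$ the derivative $G^{(r)}$ exists on $(t_i,t_{i+1})$ and $G^{(r)}(t)=\epsilon(-1)^ig(t)$ there. An $r$-th order primitive of $g$ or of $-g$ is a perfect $g$-spline of order $r$ with $0$ knots. $\Gamma^r_{n,g}[0,\infty)$ is the set of all perfect $g$-splines of order $r$ on $[0,\infty)$ with at most $n$ knots. Oscillation: for continuous $\varphi<\Phi$ on $[0,\infty)$, a continuous $x$ has $n$ positively oriented points of oscillation between $\varphi$ and $\Phi$ if $\varphi(t)\le x(t)\le\Phi(t)$ for all $t$ and there are points $s_1<\ldots<s_n$ in $[0,\infty)$ with $x(s_k)=\Phi(s_k)$ for odd $k$ and $x(s_k)=\varphi(s_k)$ for even $k$. The points are negatively oriented if instead $x(s_k)=\Phi(s_k)$ for even $k$ and $x(s_k)=\varphi(s_k)$ for odd $k$. *)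

(* Defs.v *)
From HB Require Import structures.
From mathcomp Require Export all_boot all_order all_algebra.
From mathcomp Require Export all_classical all_reals all_analysis.
Set Implicit Arguments.
Unset Strict Implicit.
Unset Printing Implicit Defensive.
Import Order.TTheory GRing.Theory Num.Def Num.Theory.
Export numFieldNormedType.Exports.
Local Open Scope classical_set_scope.
Local Open Scope ring_scope.

(* Functions on [0, oo) are represented by total functions R -> R of which only
   the values on [0, oo) matter. *)
Section Definitions.
Context {R : realType}.
Implicit Types (f g fm fp x y phi Phi : R -> R) (k n r : nat).

Notation mu := (@lebesgue_measure R).

Definition halfline : set R := `[0, +oo[.

Definition cont_halfline f : Prop := {within halfline, continuous f}.

Definition nonincreasing_halfline f : Prop :=
  forall s t : R, 0 <= s -> s <= t -> f t <= f s.

Definition positive_halfline f : Prop := forall t : R, 0 <= t -> 0 < f t.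

(* The derivative relative to [0, oo): two-sided at t > 0, one-sided at 0. *)
Definition hquot f (t h : R) : R := h^-1 * (f (h + t) - f t).

Definition hfilter (t : R) : set_system R :=
  within [set h | 0 <= h + t] (0 : R)^'.

Lemma hfilter_pos (t : R) : 0 < t -> hfilter t = (0 : R)^'.
Proof.
move=> t0; apply/funext => B; apply/propext; rewrite /hfilter /within /=.
split=> [HB|]; last by apply: filterS => h Bh _.
have Ht : \forall h \near (0 : R)^', 0 <= h + t.
  apply: nbhs_dnbhs; have : - t < 0 by rewrite oppr_lt0.
  by move=> /lt_nbhsr; apply: filterS => h; rewrite -subr_gt0 opprK => /ltW.
by apply: filterS2 Ht HB => h /[swap]; apply.
Qed.

Lemma hfilter0 : hfilter 0 = (0 : R)^'+.
Proof.
apply/funext => B; apply/propext.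
rewrite /hfilter /at_right /dnbhs /within /=.
split; apply: (@filterS _ (nbhs (0 : R))) => h /= H.
- by move=> h0; apply: H; rewrite ?gt_eqF// addr0 ltW.
- by move=> hn0; rewrite addr0 => h0; apply: H; rewrite lt_neqAle eq_sym hn0.
Qed.

Definition derivableh f (t : R) : Prop := cvg (hquot f t @ hfilter t).

Definition deriveh f (t : R) : R := lim (hquot f t @ hfilter t).

Definition derivenh n f : R -> R := iter n deriveh f.

Definition nderivableh n f : Prop :=
  forall j, (j < n)%N -> forall t : R, 0 <= t -> derivableh (derivenh j f) t.

Definition Cn_halfline n f : Prop :=
  nderivableh n f /\ cont_halfline (derivenh n f).

Definition abs_continuous (a b : R) f : Prop :=
  forall e : R, 0 < e -> exists2 d : R, 0 < d &
    forall n (u v : 'I_n -> R),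
      (forall i, [/\ a <= u i, u i <= v i & v i <= b]) ->
      (forall i j, i != j -> v i <= u j \/ v j <= u i) ->
      \sum_(i < n) (v i - u i) < d ->
      \sum_(i < n) `|f (v i) - f (u i)| < e.

Definition loc_abs_continuous f : Prop :=
  forall b : R, 0 <= b -> abs_continuous 0 b f.

Fixpoint gprim g k : R -> R :=
  if k is k'.+1 then fun t => \int[mu]_(s in `[0, t]) gprim g k' s else g.

Definition taylorA (A : nat -> \bar R) k (t : R) : R :=
  \sum_(s < k) (-1) ^+ (k - s - 1) * fine (A s) / ((k - s - 1)`!)%:R
               * t ^+ (k - s - 1).

(* [Aseq g n] lists A_0, ..., A_(n-1). The integrands are continuous and, as
   long as the preceding A_s are finite and g > 0, nonnegative, so that
   [Acst g k < +oo] says that the improper integral converges. *)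
Fixpoint Aseq g n : seq (\bar R) :=
  if n is k.+1 then
    rcons (Aseq g k)
      (\int[mu]_(t in halfline)
         (taylorA (nth 0%E (Aseq g k)) k t + (-1) ^+ k * gprim g k t)%:E)%E
  else [::].

Definition Acst g k : \bar R := nth 0%E (Aseq g k.+1) k.

Lemma size_Aseq g n : size (Aseq g n) = n.
Proof. by elim: n => //= n IH; rewrite size_rcons IH. Qed.

Lemma nth_Aseq g n s : (s < n)%N -> nth 0%E (Aseq g n) s = Acst g s.
Proof.
elim: n => // n IH; rewrite ltnS leq_eqVlt => /orP[/eqP -> //|sn].
by rewrite /= nth_rcons size_Aseq sn IH.
Qed.

Lemma AcstE g k : Acst g k =
  (\int[mu]_(t in halfline)
     (taylorA (Acst g) k t + (-1) ^+ k * gprim g k t)%:E)%E.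
Proof.
rewrite {1}/Acst /= nth_rcons size_Aseq ltnn eqxx; congr integral.
apply/funext => t; congr (_ + _)%:E; apply: eq_bigr => s _.
by rewrite nth_Aseq.
Qed.

Definition Pfun r g (t : R) : R :=
  (-1) ^+ r * taylorA (Acst g) r t + gprim g r t.

Definition at_infty f : R := lim (f t @[t --> +oo]).

Definition assumption1 r g : Prop :=
  [/\ cont_halfline g, positive_halfline g, nonincreasing_halfline g
    & forall k, (k < r)%N -> (Acst g k < +oo)%E].

Definition assumption2 f : Prop :=
  [/\ cont_halfline f, nonincreasing_halfline f, positive_halfline f
    & 0 < at_infty f].

Definition assumption3 r g f : Prop :=
  limf_einf (fun t : R => ((f t - at_infty f) / `|Pfun r g t|)%:E)
            (pinfty_nbhs R) = 0%E.

Definition supnorm x : \bar R := ereal_sup [set `|x t|%:E | t in halfline].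

Definition wnorm fm fp x : \bar R :=
  ereal_sup [set `|Num.max (x t) 0 / fp t + Num.max (- x t) 0 / fm t|%:E
            | t in halfline].

Definition Wclass r fm fp g : set (R -> R) := [set x |
  [/\ cont_halfline x,
      nderivableh r.-1 x,
      loc_abs_continuous (derivenh r.-1 x),
      (wnorm fm fp x < +oo)%E
    & {ae mu, forall t : R, 0 <= t ->
         derivableh (derivenh r.-1 x) t /\ `|derivenh r x t| <= g t}]].

Definition Wball r fm fp g (delta : R) : set (R -> R) :=
  Wclass r fm fp g `&` [set x | (wnorm fm fp x <= delta%:E)%E].

Definition omega r fm fp g k (delta : R) : \bar R :=
  ereal_sup [set supnorm (derivenh k x) | x in Wball r fm fp g delta].

Definition omega_attained r fm fp g k (delta : R) y : Prop :=
  Wball r fm fp g delta y /\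
  supnorm (derivenh k y) = omega r fm fp g k delta.

(* [t 1 < ... < t n] are the knots, [t 0 = 0], and the n-th interval is
   (t n, oo). For n = 0 this says that G is an r-th primitive of g or -g. *)
Definition perfect_gspline r g n (G : R -> R) : Prop :=
  Cn_halfline r.-1 G /\
  exists (t : nat -> R) (eps : R),
    [/\ t 0%N = 0,
        forall i, (i < n)%N -> t i < t i.+1,
        eps = 1 \/ eps = -1
      & forall i, (i <= n)%N -> forall u : R,
          t i < u -> ((i < n)%N -> u < t i.+1) ->
          derivableh (derivenh r.-1 G) u /\
          derivenh r G u = eps * (-1) ^+ i * g u].

Definition Gamma r n g : set (R -> R) :=
  [set G | exists2 m, (m <= n)%N & perfect_gspline r g m G].

(* [pos = true]: positively oriented points; [pos = false]: negatively
   oriented points. *)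
Definition oscillates (pos : bool) n phi Phi x : Prop :=
  (forall t : R, 0 <= t -> phi t <= x t <= Phi t) /\
  exists s : nat -> R,
    [/\ forall k, (1 <= k <= n)%N -> 0 <= s k,
        forall k, (1 <= k < n)%N -> s k < s k.+1
      & forall k, (1 <= k <= n)%N ->
          x (s k) = if odd k == pos then Phi (s k) else phi (s k)].

Definition threshold_seq (a : nat -> \bar R) : Prop :=
  [/\ a 0%N = +oo%E,
      forall n, (1 <= n)%N -> (0 < a n < +oo)%E,
      forall n, (1 <= n)%N -> (a n.+1 <= a n)%E
    & a @ \oo --> 0%E].

Definition oscillating_family (pos : bool) r fm fp g
    (a : nat -> \bar R) (G : R -> R -> R) : Prop :=
  forall n (tau : R), (a n.+1 <= tau%:E < a n)%E ->
    [/\ Gamma r n g (G tau),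
        perfect_gspline r g n (G tau)
      & oscillates pos n.+1 (fun t => - (tau * fm t)) (fun t => tau * fp t)
          (G tau)].

End Definitions.

(* Main.v *)
From mathcomp Require Import ring lra.
Require Import Defs.
Set Implicit Arguments.
Unset Strict Implicit.
Unset Printing Implicit Defensive.
Import Order.TTheory GRing.Theory Num.Def Num.Theory.
Local Open Scope classical_set_scope.
Local Open Scope ring_scope.

(** Write $r = m+1$ and let $c$ be $1$ for $G = G_\delta^+$ and $-1$ for
    $G = G_\delta^-$. Since $f_\pm$ and $g$ are non-increasing, the translates
    $x(\cdot+T)$ of an admissible $x$ obey the same bounds as $x$, so the
    problem is to compare $x^{(k)}(T)$ with $G^{(k)}(0)$. The two orientations
    bound $x^{(k)}(T)$ from the two sides, and each $G_\delta^\pm$ is itself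
    admissible; this gives the value of the supremum and where it is attained.

    The comparison is a count of sign changes. Let $\lambda\in[0,1)$ and
    $D = G - \lambda x(\cdot+T)$.

    - On each interval between consecutive knots $D^{(m)}$ is strictly monotone,
      in the direction of $G^{(m)}$, because the increments of $x^{(m)}$ there
      are dominated by those of $G^{(m)}$ ([spline_dominates]). With $n$ knots,
      the increments of $D^{(m)}$ thus change direction at most $n$ times
      ([alternately_monotone_zigzags]).
    - By Rolle, alternating values of $D^{(j)}$ produce alternating values of
      $D^{(j+1)}$, one fewer. For $j\ge1$ nothing is lost: beyond its last
      alternation point $D^{(j)}$ must move back towards zero, since otherwise
      $D$ would grow without bound ([chain_tail]). So $D^{(m)}$ varies at least
      as often as $D^{(j)}$ alternates ([no_alternation]).
    - The $n+1$ points of oscillation make $D$ alternate $n+1$ times, hence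
      $D^{(k)}$ alternates $n$ times, starting with the sign $c(-1)^k$. If
      $c(-1)^k x^{(k)}(T) > |G^{(k)}(0)|$, then for $\lambda$ close to $1$ the
      value $D^{(k)}(0)$ has the opposite sign and adds an alternation in front.
      Then $D^{(m)}$ has $n+1$ alternating increments beginning in the direction
      opposite to that of $G^{(m)}$ on its first interval: one too many
      ([comparison]).

    The last step needs to know the sign of $G^{(r)}$ near $0$. The same count
    with $\lambda=0$ gives it: after its last point of oscillation $G$ has to
    leave its extreme value, so that $G'$ alternates $n+1$ times
    ([spline_sign]).

    The domination of increments rests on one fact about absolutely continuous
    functions: a derivative that is nonnegative almost everywhere forces the
    function to be nondecreasing ([ac_nondecreasing]). *)

(** * Counting sign alternations of successive derivatives *)

Section Alternation.
Context {R : realType}.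
Implicit Types (F : R -> R) (D X Y : nat -> R -> R) (c s t : R) (m n j r : nat).

(** The successive derivatives are carried as a family of functions, so that
    translates and differences are formed member by member and one-sided
    derivatives at [0] never have to be recomputed. *)
Definition deriv_chain m D : Prop :=
  (forall j, (j <= m)%N -> cont_halfline (D j)) /\
  (forall j, (j < m)%N -> forall t, 0 < t -> is_derive t 1 (D j) (D j.+1 t)).

Lemma chain_MVT m D j a b : deriv_chain m D -> (j < m)%N -> 0 <= a -> a < b ->
  exists2 c, a < c < b & D j b - D j a = D j.+1 c * (b - a).
Proof.
move=> [cD dD] jm a0 ab.
have [||c] := @MVT R (D j) (D j.+1) a b ab.
- by move=> x /[!in_itv]/= /andP[ax _]; apply: dD => //; exact: le_lt_trans ax.
- apply: continuous_subspaceW (cD j (ltnW jm)) => x /=.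
  by rewrite /halfline /= !in_itv/= andbT => /andP[ax _]; exact: le_trans ax.
by rewrite in_itv/= => ? ?; exists c.
Qed.

Lemma chain_lin m X Y c : deriv_chain m X -> deriv_chain m Y ->
  deriv_chain m (fun j t => X j t - c * Y j t).
Proof.
move=> [cX dX] [cY dY]; split=> [j jm | j jm t t0].
- have cXj := cX j jm; have cYj := cY j jm => z.
  apply: cvgB; first exact: cXj.
  by apply: cvgM; [exact: cvg_cst | exact: cYj].
- have dXj := dX j jm t t0; have dYj := dY j jm t t0.
  have := is_deriveB dXj (is_deriveZ c dYj).
  by apply.
Qed.

Definition alternates F c m : Prop := exists p : nat -> R,
  [/\ 0 <= p 0%N, forall i, (i.+1 < m)%N -> p i < p i.+1
    & forall i, (i < m)%N -> 0 < c * (-1) ^+ i * F (p i)].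

Definition zigzags F c m : Prop := exists p : nat -> R,
  [/\ 0 <= p 0%N, forall i, (i < m)%N -> p i < p i.+1
    & forall i, (i < m)%N -> 0 < c * (-1) ^+ i * (F (p i.+1) - F (p i))].

Lemma alternates_zigzags F c m : alternates F c m.+1 -> zigzags F (- c) m.
Proof.
move=> [p [p0 pS pF]]; exists p; split=> // i im.
have := pF i (leqW im); have := pF i.+1 im; rewrite exprS; lra.
Qed.

Lemma le_incr_nat (p : nat -> R) m i : (forall i, (i < m)%N -> p i < p i.+1) ->
  (i <= m)%N -> p 0%N <= p i.
Proof.
move=> pS; elim: i => // i IH im.
by rewrite (le_trans (IH (ltnW im)))// ltW// pS.
Qed.

Lemma zigzags_deriv m D j c n : deriv_chain m D -> (j < m)%N ->
  zigzags (D j) c n -> alternates (D j.+1) c n.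
Proof.
move=> cD jm [p [p0 pS pD]].
have /choice[q qP] (i : nat) : exists q : R, (i < n)%N ->
    [/\ p i < q, q < p i.+1 & 0 < c * (-1) ^+ i * D j.+1 q].
  have [im|] := ltnP i n; last by exists 0.
  have [|q /andP[piq qpi] E] := chain_MVT cD jm _ (pS i im).
    exact: le_trans (le_incr_nat pS (ltnW im)).
  exists q => _; split => //; move: (pD i im).
  by rewrite E mulrA pmulr_lgt0// subr_gt0 pS.
case: n => [|n] in pS pD qP *.
  by exists (fun=> 0); split.
exists q; split.
- by have [pq _ _] := qP 0%N isT; rewrite (le_trans p0)// ltW.
- move=> i im; have [_ + _] := qP i (ltnW im).
  by have [+ _ _] := qP i.+1 im => /[swap]; exact: lt_trans.
- by move=> i im; have [] := qP i im.
Qed.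

(** A derivative of positive order bounded away from zero on a half-line makes
    each lower one unbounded there. *)
Lemma chain_growth m D j s q e : deriv_chain m D -> (j <= m)%N -> 0 <= q ->
  0 < e -> (forall u, q <= u -> e <= s * D j u) -> (0 < j)%N ->
  forall M, exists2 q', 0 <= q' & forall u, q' <= u -> M <= s * D 0%N u.
Proof.
move=> cD; elim: j => [//|j IH] in q e *.
move=> jm q0 e0 H _ M.
have grow (K : R) : exists2 q', q <= q' & forall u, q' <= u -> K <= s * D j u.
  have [w w0 wK] : exists2 w, 0 <= w & K - s * D j q <= e * w.
    exists (`|K - s * D j q| / e); first by rewrite divr_ge0// ltW.
    by rewrite mulrCA divff ?gt_eqF// mulr1 ler_norm.
  exists (q + 1 + w); first by lra.
  move=> u qu; have qu' : q < u by lra.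
  have [v /andP[qv _] E] := chain_MVT cD jm q0 qu'.
  have : e * (u - q) <= s * D j.+1 v * (u - q).
    by apply: ler_wpM2r; [lra | apply: H; exact: ltW].
  have : e * w <= e * (u - q) by rewrite ler_wpM2l//; lra.
  have -> : s * D j u = s * D j q + s * D j.+1 v * (u - q).
    by rewrite -mulrA -E; ring.
  lra.
have [j0|j0] := posnP j.
  by rewrite j0 in grow; have [q' qq' ?] := grow M; exists q' => //; lra.
have [q' qq' Hq'] := grow 1.
by apply: (IH q' 1) => //; [exact: ltnW | lra].
Qed.

(** Boundedness of [D 0] acts as an additional alternation point at infinity:
    it provides the increment that Rolle's theorem would otherwise lose. *)
Lemma chain_tail m D j s q B : deriv_chain m D ->
  (forall u, 0 <= u -> `|D 0%N u| <= B) -> (0 < j <= m)%N -> 0 <= q ->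
  0 < s * D j q -> exists2 q', q < q' & s * D j q' < s * D j q.
Proof.
move=> cD bD /andP[j0 jm] q0 sq; apply: contrapT => H.
have [|u u0 /(_ _ (lexx u))] :=
    chain_growth (s := s) (e := s * D j q) cD jm q0 sq _ j0 (`|s| * B + 1).
  move=> u; rewrite le_eqVlt => /predU1P[->//|qu]; rewrite leNgt.
  by apply/negP => qu'; apply: H; exists u.
have : s * D 0%N u <= `|s| * B.
  by rewrite (le_trans (ler_norm _))// normrM ler_wpM2l// bD.
lra.
Qed.

Lemma zigzags_extend F c n (p : nat -> R) q : 0 <= p 0%N ->
  (forall i, (i < n)%N -> p i < p i.+1) ->
  (forall i, (i <= n)%N -> 0 < c * (-1) ^+ i * F (p i)) ->
  p n < q -> c * (-1) ^+ n * F q < c * (-1) ^+ n * F (p n) ->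
  zigzags F (- c) n.+1.
Proof.
move=> p0 pS pF pq Fq; exists (fun i => if (i <= n)%N then p i else q).
split => // i.
- rewrite ltnS => im; rewrite im; case: ifPn => [|/negbTE H]; first exact: pS.
  by have -> // : i = n; apply/eqP; rewrite eqn_leq im leqNgt H.
- rewrite ltnS => im; rewrite im; case: ifPn => [im'|H].
    have := pF i im; have := pF i.+1 im'; rewrite exprS; lra.
  have -> : i = n by apply/eqP; rewrite eqn_leq im leqNgt H.
  lra.
Qed.

Lemma alternates_zigzags_tail m D j c n B : deriv_chain m D ->
  (forall u, 0 <= u -> `|D 0%N u| <= B) -> (0 < j <= m)%N ->
  alternates (D j) c n -> zigzags (D j) (- c) n.
Proof.
move=> cD bD jm; case: n => [|n] [p [p0 pS pD]]; first by exists (fun=> 0).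
have pn0 : 0 <= p n by rewrite (le_trans p0)// (@le_incr_nat p n).
have [q pq qD] := chain_tail cD bD jm pn0 (pD n (leqnn _)).
exact: (zigzags_extend p0 pS pD pq qD).
Qed.

Lemma alternates_up m D j i c n B : deriv_chain m D ->
  (forall u, 0 <= u -> `|D 0%N u| <= B) -> (0 < j)%N -> (j + i <= m)%N ->
  alternates (D j) c n -> alternates (D (j + i)%N) (c * (-1) ^+ i) n.
Proof.
move=> cD bD j0; elim: i => [|i IH] jim aD; first by rewrite addn0 mulr1.
rewrite exprS mulN1r mulrN addnS; rewrite addnS in jim.
apply: (zigzags_deriv cD) => //; apply: (alternates_zigzags_tail cD bD).
  by apply/andP; split; [rewrite addn_gt0 j0 | exact: ltnW].
by apply: IH => //; exact: ltnW.
Qed.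

(** If the first alternation point were 0 itself, both sign conditions would
    bear on [F 0]; so it is positive and 0 can be put in front of it. *)
Lemma alternates_prepend F c n : alternates F c n -> c * F 0 < 0 ->
  alternates F (- c) n.+1.
Proof.
move=> [p [p0 pS pF]] F0; exists (fun i => if i is i'.+1 then p i' else 0).
split=> //.
- move=> [|i]; last exact: pS.
  rewrite ltnS => /pF; rewrite expr0 mulr1 => Fp0.
  move: p0; rewrite le_eqVlt => /predU1P[p0|//].
  by move: Fp0; rewrite -p0 ltNge ltW.
- case=> [_|i]; first by rewrite expr0; lra.
  by rewrite ltnS => /pF; rewrite exprS; lra.
Qed.

Definition alternately_monotone F (t : nat -> R) n (eps : R) : Prop :=
  forall i, (i <= n)%N -> forall u v, t i <= u -> u < v ->
    ((i < n)%N -> v <= t i.+1) -> 0 < eps * (-1) ^+ i * (F v - F u).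

(** Starting against the direction of the first interval, every increment must
    reach past the next knot before it can have its sign. After [n] increments
    the last knot is passed, and the next one has the wrong direction. *)
Lemma alternately_monotone_zigzags F (t : nat -> R) n eps : t 0%N = 0 ->
  alternately_monotone F t n eps -> ~ zigzags F (- eps) n.+1.
Proof.
move=> t0 mF [p [p0 pS pF]].
have pt i : (i <= n)%N -> t i <= p i.
  elim: i => [|i IH] im; first by rewrite t0.
  rewrite leNgt; apply/negP => pt.
  have := pF i (leqW im).
  have := mF i (ltnW im) (p i) (p i.+1) (IH (ltnW im)) (pS _ (leqW im))
            (fun=> ltW pt).
  lra.
have := pF n (leqnn _).
have := mF n (leqnn _) (p n) (p n.+1) (pt _ (leqnn _)) (pS _ (leqnn _)).
rewrite ltnn => /(_ (fun h => False_ind _ (notF h))).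
lra.
Qed.

(** The sign of [c] is such that [m - j] differentiations, each of which flips
    the initial sign, lead to [n.+1] increments of [D m] beginning against
    [eps]. *)
Lemma no_alternation m D j c n B (t : nat -> R) eps : deriv_chain m D ->
  (forall u, 0 <= u -> `|D 0%N u| <= B) -> (0 < j <= m)%N -> t 0%N = 0 ->
  alternately_monotone (D m) t n eps -> c = eps * (-1) ^+ (m - j) ->
  ~ alternates (D j) c n.+1.
Proof.
move=> cD bD /andP[j0 jm] t0 mD -> aD; apply: (alternately_monotone_zigzags t0 mD).
have := @alternates_up m D j (m - j)%N _ _ _ cD bD j0 _ aD.
rewrite subnKC// leqnn -mulrA -exprMn mulrNN mulr1 expr1n mulr1 => /(_ isT) aDm.
apply: (alternates_zigzags_tail cD bD _ aDm).
by rewrite leqnn (leq_trans j0).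
Qed.

End Alternation.

(** * Absolutely continuous functions with nonnegative derivative *)

Section AbsoluteContinuity.
Context {R : realType}.
Implicit Types (a b c d e s t : R) (f chi : R -> R) (N U : set R).
Notation mu := (@lebesgue_measure R).

Lemma is_derive_hquot f t l : is_derive t 1 f l <-> hquot f t @ (0 : R)^' --> l.
Proof.
have E : (fun h : R => h^-1 *: ((f \o shift t) (h *: (1 : R)) - f t)) = hquot f t.
  by apply/funext => h; rewrite /hquot /= /GRing.scale/= mulr1.
split=> [[]|H]; first by rewrite /derivable /derive E => /[swap] <-.
split; first by rewrite /derivable E; apply/cvg_ex; exists l.
by rewrite /derive E; exact/cvg_lim.
Qed.

(** Local monotonicity around each point propagates along a compact interval:
    the supremum of the points up to which the inequality holds cannot lie
    before [b]. *)
Lemma local_nondecreasing chi a b : a <= b ->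
  (forall t, a <= t <= b -> exists2 d, 0 < d & forall u, a <= u <= b ->
     (t - d < u -> u <= t -> chi u <= chi t) /\
     (t <= u -> u < t + d -> chi t <= chi u)) ->
  chi a <= chi b.
Proof.
move=> ab H; pose S := [set s | a <= s <= b /\ chi a <= chi s].
have Sa : S a by split; rewrite ?lexx.
have ubS : ubound S b by move=> s [/andP[]].
have hS : has_sup S by split; [exists a | exists b].
have ac : a <= sup S by exact: (ub_le_sup hS.2).
have cb : sup S <= b by exact: (ge_sup hS.1).
have [|d d0 Hd] := H (sup S); first by rewrite ac.
have [s [abs chis] cs] := sup_adherent d0 hS.
have Sc : chi a <= chi (sup S).
  apply: (le_trans chis); have [+ _] := Hd s abs; apply => //.
  by apply: (ub_le_sup hS.2); split.
have [<-//|cb'] : sup S = b \/ sup S < b.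
  by move: cb; rewrite le_eqVlt => /predU1P[]; [left|right].
pose v := minr (sup S + d / 2) b.
have cv : sup S < v by rewrite /v lt_min cb' andbT; lra.
have vd : v < sup S + d.
  by apply: (@le_lt_trans _ _ (sup S + d / 2)); [rewrite /v ge_min lexx|lra].
have abv : a <= v <= b by rewrite (le_trans ac (ltW cv)) /v ge_min lexx orbT.
have Sv : S v.
  split => //; apply: (le_trans Sc); have [_] := Hd v abv; apply => //.
  exact: ltW.
have := ub_le_sup hS.2 Sv; lra.
Qed.

Lemma derive_ge0_local f t l e : is_derive t 1 f l -> 0 <= l -> 0 < e ->
  exists2 d, 0 < d & forall u, `|u - t| < d ->
    (u <= t -> f u + e * u <= f t + e * t) /\
    (t <= u -> f t + e * t <= f u + e * u).
Proof.
move=> /is_derive_hquot fl l0 e0.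
have /nbhs_ballP[d /= d0 Hd] : \forall h \near (0 : R)^', - e < hquot f t h.
  apply: (cvgr_gt l) => //; lra.
exists d => // u ud.
have [->|ut] := eqVneq u t; first by split=> _; exact: lexx.
have := Hd (u - t); rewrite /ball/= sub0r normrN => /(_ ud).
rewrite subr_eq0 => /(_ ut); rewrite /hquot subrK => Hu.
split=> ut'.
- have ltu : u - t < 0 by rewrite subr_lt0 lt_neqAle ut.
  have : (u - t) * - e > (u - t) * ((u - t)^-1 * (f u - f t)).
    by rewrite ltr_nM2l.
  by rewrite mulrA divff ?subr_eq0// mul1r; lra.
- have ltu : 0 < u - t by rewrite subr_gt0 lt_neqAle eq_sym ut.
  have : (u - t) * - e < (u - t) * ((u - t)^-1 * (f u - f t)).
    by rewrite ltr_pM2l.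
  by rewrite mulrA divff ?subr_eq0// mul1r; lra.
Qed.

(** Nonoverlapping intervals inside [U]; they may be degenerate or share end
    points, to match the families in the definition of absolute continuity. *)
Definition packing a t U n (u v : nat -> R) : Prop :=
  (forall i, (i < n)%N -> [/\ a <= u i, u i <= v i, v i <= t
     & `[u i, v i] `<=` U]) /\
  (forall i j, (i < n)%N -> (j < n)%N -> i != j -> v i <= u j \/ v j <= u i).

Definition variations f a U t : set R :=
  [set x | exists n u v, packing a t U n u v /\
     x = \sum_(i < n) `|f (v i) - f (u i)|].

Lemma packing_length a t U n u v : measurable U -> packing a t U n u v ->
  ((\sum_(i < n) (v i - u i))%:E <= mu U)%E.
Proof.
move=> mU [Huv Hdis].
pose F (i : 'I_n) : set R := `]u i, v i[%classic.
have mF i : measurable (F i) by exact: measurable_itv.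
have tF : trivIset setT F.
  apply/trivIsetP => i j _ _ ij; apply/eqP/negPn/negP => /set0P[x []].
  rewrite /F /= !in_itv/= => /andP[ux xv] /andP[ux' xv'].
  have [|] := Hdis i j (ltn_ord i) (ltn_ord j) ij.
    by move=> h; lra.
  by move=> h; lra.
have <- : mu (\big[setU/set0]_(i < n) F i) = (\sum_(i < n) (v i - u i))%:E.
  rewrite measure_bigsetU_ord// -sumEFin; apply: eq_bigr => i _.
  transitivity (mu `]u i, v i[%classic) => //.
  rewrite lebesgue_measure_itv/= lte_fin; case: ltP => //.
  have [_ uv _ _] := Huv i (ltn_ord i) => vu.
  have -> : v i = u i by apply/eqP; rewrite eq_le uv vu.
  by rewrite subrr.
apply: le_measure; rewrite ?inE//; first by apply: bigsetU_measurable => i _; exact: mF.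
apply: (big_ind (fun A => A `<=` U)) => [//|A B AU BU x []|i _] /=.
- exact: AU.
- exact: BU.
- have [_ _ _ H] := Huv i (ltn_ord i); apply: subset_trans H.
  exact: subset_itv_oo_cc.
Qed.

Lemma negligible_open_cover N e : mu.-negligible N -> 0 < e ->
  exists U, [/\ open U, N `<=` U & (mu U < e%:E)%E].
Proof.
move=> [B [mB B0 NB]] e0.
have [|U [oU BU Ue]] := lebesgue_regularity_outer mB _ e0.
  by rewrite [X in (X < _)%E](_ : _ = 0%E).
exists U; split => //; first exact: subset_trans BU.
have mU : measurable U by apply: measurable_realfun.open_measurable.
rewrite (measureDI mu mU mB) (setIidr BU).
by rewrite [X in (_ + X)%E](_ : _ = 0%E)// adde0.
Qed.

(** Cover the exceptional set by an open [U] of small measure, and let [V t] be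
    the supremum of the variation sums of [f] over packings of [U] between [a]
    and [t]; absolute continuity makes it small. For every [e > 0] the function
    [f t + e * t + V t] is locally nondecreasing: where [f] has a nonnegative
    derivative because of the term [e * t], and on [U] because there [V]
    absorbs the variation of [f]. *)
Lemma ac_nondecreasing a b f N : a <= b -> abs_continuous a b f ->
  mu.-negligible N ->
  (forall t, a < t < b -> ~ N t -> exists2 l, 0 <= l & is_derive t 1 f l) ->
  f a <= f b.
Proof.
move=> ab acf nN df; apply/ler_addgt0Pr => eps eps0.
(* Half of [eps] pays for the slope [e] over [a, b], the other half for [V b].
   The end points are put into [U], where no derivative is needed. *)
pose e := eps / 2 / (b - a + 1).
have ba0 : 0 < b - a + 1 by lra.
have e0 : 0 < e by rewrite !divr_gt0.
have ee : e * (b - a) < eps / 2.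
  have : e * (b - a + 1) = eps / 2 by rewrite /e divfK// gt_eqF.
  lra.
have [|d d0 Hd] := acf (eps / 2); first by lra.
have [U [oU NU Ud]] : exists U, [/\ open U, N `|` [set a; b] `<=` U & (mu U < d%:E)%E].
  apply: negligible_open_cover => //; apply: negligibleU => //.
  by apply: negligibleU; apply/negligibleP => //; exact: lebesgue_measure_set1.
have mU : measurable U by apply: measurable_realfun.open_measurable.
pose S := variations f a U; pose V t := sup (S t).
have S0 t : S t 0.
  by exists 0%N, (fun=> 0), (fun=> 0); split; [split|rewrite big_ord0].
have Sb t x : t <= b -> S t x -> x <= eps / 2.
  move=> tb [n [u [v [pk ->]]]]; apply: ltW; apply: Hd.
  - by move=> i; have [au uv vt _] := pk.1 i (ltn_ord i); rewrite au uv (le_trans vt).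
  - by move=> i j ij; apply: pk.2.
  - by rewrite -lte_fin; apply: le_lt_trans Ud; exact: packing_length pk.
have hS t : t <= b -> has_sup (S t).
  by move=> tb; split; [exists 0|exists (eps / 2) => x; exact: Sb].
have VS s t : a <= s -> s <= t -> t <= b -> `[s, t] `<=` U ->
    V s + `|f t - f s| <= V t.
  move=> as_ st tb sU; rewrite -lerBrDr; apply: ge_sup; first by exists 0.
  move=> x [n [u [v [[pk pkd] ->]]]]; rewrite lerBrDr.
  apply: (ub_le_sup (hS t tb).2).
  exists n.+1, (fun i => if (i < n)%N then u i else s),
    (fun i => if (i < n)%N then v i else t); split; last first.
    rewrite big_ord_recr/= ltnn; congr (_ + _); apply: eq_bigr => i _.
    by rewrite ltn_ord.
  split=> [i|i j]; rewrite !ltnS.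
    move=> _; case: ifP => // ni; have [au uv vs vU] := pk i ni.
    by split => //; exact: le_trans st.
  rewrite leq_eqVlt => /predU1P[->|ni]; rewrite leq_eqVlt => /predU1P[->|nj].
  - by rewrite eqxx.
  - by rewrite ltnn nj => _; right; have [] := pk j nj.
  - by rewrite ltnn ni => _; left; have [] := pk i ni.
  - by rewrite ni nj; exact: pkd.
have : f a + e * a + V a <= f b + e * b + V b.
  apply: (@local_nondecreasing (fun t => f t + e * t + V t)) => // t atb.
  have Vmono s s' : a <= s -> s <= s' -> s' <= b -> V s <= V s'.
    move=> as_ ss' sb; apply: ge_sup; first by exists 0.
    move=> x [n [u [v [[pk pkd] ->]]]]; apply: (ub_le_sup (hS s' sb).2).
    exists n, u, v; split=> //; split=> // i ni.
    by have [? ? vs ?] := pk i ni; split => //; exact: le_trans ss'.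
  have [tU|tU] := pselect (U t).
    have /nbhs_ballP[r /= r0 rU] : nbhs t U by exact: open_nbhs_nbhs.
    exists r => // u /andP[au ub]; split=> h1 h2.
      have : V u + `|f t - f u| <= V t.
        apply: VS => //; first by lra.
        move=> x /=; rewrite in_itv/= => xut; apply: rU.
        by rewrite /ball/= ltr_norml; lra.
      have := ler_norm (f u - f t); rewrite distrC.
      have : e * u <= e * t by rewrite ler_wpM2l// ltW.
      lra.
    have : V t + `|f u - f t| <= V u.
      apply: VS => //; first by lra.
      move=> x /=; rewrite in_itv/= => xut; apply: rU.
      by rewrite /ball/= ltr_norml; lra.
    have := ler_norm (f t - f u); rewrite distrC.
    have : e * t <= e * u by rewrite ler_wpM2l// ltW.
    lra.
  have [||l l0 dl] := df t.
  - rewrite !lt_neqAle; move: atb => /andP[-> ->]; rewrite !andbT.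
    by apply/andP; split; apply/eqP => E; apply: tU; apply: NU; right; [left|right].
  - by move=> Nt; apply: tU; apply: NU; left.
  have [r r0 Hr] := derive_ge0_local dl l0 e0.
  exists r => // u /andP[au ub]; split=> h1 h2.
    have [|+ _] := Hr u; first by rewrite ltr_norml; lra.
    move=> /(_ h2); have : V u <= V t by apply: Vmono => //; lra.
    lra.
  have [|_ +] := Hr u; first by rewrite ltr_norml; lra.
  move=> /(_ h1); have : V t <= V u by apply: Vmono => //; lra.
  lra.
have : V b <= eps / 2 by apply: ge_sup; [exists 0 | move=> x; exact: Sb].
have : 0 <= V a by apply: (ub_le_sup (hS a ab).2).
lra.
Qed.

End AbsoluteContinuity.

(** * Perfect splines and functions of the class *)

Section Splines.
Context {R : realType}.
Implicit Types (f g h x G : R -> R) (a b c d e s : R) (m n j k : nat).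
Notation mu := (@lebesgue_measure R).

Lemma derivableh_is_derive f (t : R) : 0 < t -> derivableh f t ->
  is_derive t 1 f (deriveh f t).
Proof.
by move=> t0; rewrite /derivableh /deriveh hfilter_pos// => /is_derive_hquot.
Qed.

Lemma is_derive_translate f (t T l : R) : is_derive (t + T) 1 f l ->
  is_derive t 1 (fun u => f (u + T)) l.
Proof.
move=> /is_derive_hquot H; apply/is_derive_hquot.
rewrite (_ : hquot _ t = hquot f (t + T))//.
by apply/funext => h; rewrite /hquot addrA.
Qed.

Lemma cont_halflineP f : cont_halfline f <->
  forall t, 0 <= t -> forall e, 0 < e -> exists2 d, 0 < d &
    forall u, 0 <= u -> `|u - t| < d -> `|f u - f t| < e.
Proof.
rewrite /cont_halfline; split=> [/subspace_continuousP H t t0 e e0|H].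
  have /H/cvgrPdist_lt/(_ e e0) : halfline t.
    by rewrite /halfline /= in_itv/= t0.
  move=> /nbhs_ballP[d /= d0 Hd]; exists d => // u u0 ud.
  rewrite distrC; apply: Hd; first by rewrite /ball/= distrC.
  by rewrite /halfline /= in_itv/= u0.
apply/subspace_continuousP => t; rewrite /halfline /= in_itv/= andbT => t0.
apply/cvgrPdist_lt => e e0; have [d d0 Hd] := H t t0 e e0.
apply/nbhs_ballP; exists d => //= u; rewrite /ball/= distrC => ud.
by rewrite in_itv/= andbT => u0; rewrite distrC; exact: Hd.
Qed.

(** Not an instance of the two-sided statement: at [0] the difference quotient
    is one-sided. *)
Lemma derivableh_cont f : (forall t, 0 <= t -> derivableh f t) -> cont_halfline f.
Proof.
move=> df; apply/cont_halflineP => t t0 e e0.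
have : hquot f t @ hfilter t --> deriveh f t by exact: df.
set l := deriveh f t.
have hF : Filter (hfilter t) by exact: within_filter.
move=> /cvgrPdist_lt/(_ 1 ltr01)/nbhs_ballP[d /= d0 Hd].
have l1 : 0 < `|l| + 1 by rewrite ltr_pwDr.
exists (minr d (e / (`|l| + 1))); first by rewrite lt_min d0 divr_gt0.
move=> u u0; rewrite lt_min => /andP[ud ue].
have [->|ut] := eqVneq u t; first by rewrite subrr normr0.
have := Hd (u - t); rewrite /ball/= sub0r normrN => /(_ ud).
rewrite subr_eq0 => /(_ ut); rewrite subrK => /(_ u0).
rewrite /hquot subrK => Hu.
have -> : f u - f t = (u - t) * ((u - t)^-1 * (f u - f t)).
  by rewrite mulrA divff ?subr_eq0// mul1r.
rewrite normrM; set q := _^-1 * _ in Hu *.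
have ql : `|q| <= `|l| + 1.
  by have := ler_normB l (l - q); rewrite subKr; lra.
have ut0 : 0 < `|u - t| by rewrite normr_gt0 subr_eq0.
apply: (@le_lt_trans _ _ (`|u - t| * (`|l| + 1))); first by rewrite ler_pM2l.
by rewrite -ltr_pdivlMr.
Qed.

Lemma derivenh_chain m x : nderivableh m x -> cont_halfline (derivenh m x) ->
  deriv_chain m (fun j => derivenh j x).
Proof.
move=> dx cx; split=> [j|j jm t t0].
  rewrite leq_eqVlt => /predU1P[->//|jm].
  by apply: derivableh_cont => t t0; exact: dx.
by apply: derivableh_is_derive => //; apply: dx => //; exact: ltW.
Qed.

Lemma chain_translate m (X : nat -> R -> R) T : 0 <= T -> deriv_chain m X ->
  deriv_chain m (fun j u => X j (u + T)).
Proof.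
move=> T0 [cX dX]; split=> [j jm|j jm t t0]; last first.
  by apply: is_derive_translate; apply: dX => //; rewrite ltr_wpDr.
apply/cont_halflineP => t t0 e e0.
have /cont_halflineP/(_ (t + T) (addr_ge0 t0 T0) e e0)[d d0 Hd] := cX j jm.
exists d => // u u0 ud; apply: Hd; first exact: addr_ge0.
by rewrite opprD addrACA subrr addr0.
Qed.

Lemma ac_perturb a b f h L : abs_continuous a b f -> 0 <= L ->
  (forall u v, a <= u -> u <= v -> v <= b ->
    `|h v - h u| <= `|f v - f u| + L * (v - u)) ->
  abs_continuous a b h.
Proof.
move=> acf L0 H e e0.
have [|d d0 Hd] := acf (e / 2); first by lra.
have L1 : 0 < L + 1 by lra.
exists (minr d (e / 2 / (L + 1))).
  by rewrite lt_min d0/= !divr_gt0.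
move=> n u v uv dis; rewrite lt_min => /andP[sd se].
have := Hd n u v uv dis sd.
have le1 : L * \sum_(i < n) (v i - u i) <= (L + 1) * \sum_(i < n) (v i - u i).
  apply: ler_wpM2r; last by lra.
  by apply: sumr_ge0 => i _; have [_ + _] := uv i; rewrite subr_ge0.
have : (L + 1) * \sum_(i < n) (v i - u i) < e / 2.
  by rewrite mulrC -ltr_pdivlMr.
have : \sum_(i < n) `|h (v i) - h (u i)| <=
    \sum_(i < n) `|f (v i) - f (u i)| + L * \sum_(i < n) (v i - u i).
  rewrite mulr_sumr -big_split/=; apply: ler_sum => i _.
  by have [? ? ?] := uv i; exact: H.
lra.
Qed.

Lemma lipschitz_loc_ac h L : 0 <= L ->
  (forall u v, 0 <= u -> u <= v -> `|h v - h u| <= L * (v - u)) ->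
  loc_abs_continuous h.
Proof.
move=> L0 H b b0; apply: (@ac_perturb _ _ (fun=> 0) _ L) => //.
  move=> e e0; exists 1 => // n u v _ _ _.
  by rewrite big1// => i _; rewrite subrr normr0.
by move=> u v u0 uv vb; rewrite subrr normr0 add0r H.
Qed.

Lemma loc_ac_cont f : loc_abs_continuous f -> cont_halfline f.
Proof.
move=> acf; apply/cont_halflineP => t t0 e e0.
have [|d d0 Hd] := acf (t + 1) _ e e0; first by lra.
have {}Hd u v : 0 <= u -> u <= v -> v <= t + 1 -> v - u < d -> `|f v - f u| < e.
  move=> u0 uv vt vud; have := Hd 1%N (fun=> u) (fun=> v).
  rewrite !big_ord1; apply=> // i j; by rewrite !ord1 eqxx.
exists (minr d 1); first by rewrite lt_min d0 ltr01.
move=> u u0; rewrite lt_min => /andP[/ltr_normlP[? ?] /ltr_normlP[? ?]].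
have [ut|/ltW tu] := leP u t; last by apply: Hd; lra.
by rewrite distrC; apply: Hd; lra.
Qed.

Lemma Wclass_chain m fm fp g x : Wclass m.+1 fm fp g x ->
  deriv_chain m (fun j => derivenh j x).
Proof.
by move=> [_ dx /loc_ac_cont cx _ _]; exact: derivenh_chain.
Qed.

Definition spline_data m g n G (t : nat -> R) eps : Prop :=
  [/\ deriv_chain m (fun j => derivenh j G), t 0%N = 0,
      forall i, (i < n)%N -> t i < t i.+1,
      eps = 1 \/ eps = -1
    & forall i, (i <= n)%N -> forall u, t i < u ->
        ((i < n)%N -> u < t i.+1) ->
        is_derive u 1 (derivenh m G) (eps * (-1) ^+ i * g u)].

Lemma knot_ge0 n (t : nat -> R) i : t 0%N = 0 ->
  (forall i, (i < n)%N -> t i < t i.+1) -> (i <= n)%N -> 0 <= t i.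
Proof. by move=> t0 tS im; rewrite -t0; exact: (le_incr_nat tS). Qed.

Lemma gspline_data m g n G : perfect_gspline m.+1 g n G ->
  exists t eps, spline_data m g n G t eps.
Proof.
move=> [[dG cG] [t [eps [t0 tS eps1 dGm]]]]; exists t, eps; split => //.
  exact: derivenh_chain.
move=> i im u tu ut; have [du <-] := dGm i im u tu ut.
apply: derivableh_is_derive du.
exact: le_lt_trans (knot_ge0 t0 tS im) tu.
Qed.

Lemma spline_MVT m g n G t eps i u v : spline_data m g n G t eps ->
  (i <= n)%N -> t i <= u -> u < v -> ((i < n)%N -> v <= t i.+1) ->
  exists2 w, u < w < v &
    derivenh m G v - derivenh m G u = eps * (-1) ^+ i * g w * (v - u).
Proof.
move=> [[cG _] t0 tS _ dG] im tu uv vt.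
have [||w] := @MVT R (derivenh m G) (fun w => eps * (-1) ^+ i * g w) u v uv.
- move=> w; rewrite in_itv/= => /andP[uw wv]; apply: dG => //.
    exact: le_lt_trans uw.
  by move=> /vt; exact: lt_le_trans.
- apply: continuous_subspaceW (cG m (leqnn _)) => w /=.
  rewrite /halfline /= !in_itv/= andbT => /andP[uw _].
  by rewrite (le_trans _ uw)// (le_trans _ tu)// (knot_ge0 t0 tS).
by rewrite in_itv/= => uwv E; exists w.
Qed.

Lemma sign_sq eps i : eps = 1 \/ eps = -1 -> (eps * (-1) ^+ i) ^+ 2 = 1 :> R.
Proof. by rewrite exprMn sqrr_sign mulr1 => -[]->; rewrite ?sqrrN expr1n. Qed.

Lemma norm_sign eps i : eps = 1 \/ eps = -1 -> `|eps * (-1) ^+ i| = 1 :> R.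
Proof.
by rewrite normrM normr_sign mulr1 => -[]->; rewrite ?normrN normr1.
Qed.

(** The mean value theorem gives the constant [g 0] between knots; the pieces
    are then glued knot by knot. *)
Lemma spline_lipschitz m g n G t eps : spline_data m g n G t eps ->
  positive_halfline g -> nonincreasing_halfline g ->
  forall u v, 0 <= u -> u <= v ->
    `|derivenh m G v - derivenh m G u| <= g 0 * (v - u).
Proof.
move=> sG g0 gni.
have [_ t0 tS eps1 _] := sG.
have piece i u v : (i <= n)%N -> t i <= u -> u <= v ->
    ((i < n)%N -> v <= t i.+1) ->
    `|derivenh m G v - derivenh m G u| <= g 0 * (v - u).
  move=> im tu; rewrite le_eqVlt => /predU1P[->|uv vt].
    by rewrite !subrr normr0 mulr0.
  have [w /andP[uw wv] ->] := spline_MVT sG im tu uv vt.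
  have w0 : 0 <= w.
    by rewrite (le_trans _ (ltW uw))// (le_trans _ tu)// (knot_ge0 t0 tS).
  rewrite !normrM -normrM norm_sign// mul1r (gtr0_norm (g0 w w0)).
  rewrite gtr0_norm ?subr_gt0//; apply: ler_wpM2r; first by rewrite subr_ge0 ltW.
  exact: gni.
have glue w u v : u <= w -> w <= v ->
    `|derivenh m G w - derivenh m G u| <= g 0 * (w - u) ->
    `|derivenh m G v - derivenh m G w| <= g 0 * (v - w) ->
    `|derivenh m G v - derivenh m G u| <= g 0 * (v - u).
  move=> uw wv; have := ler_normD (derivenh m G v - derivenh m G w)
    (derivenh m G w - derivenh m G u).
  rewrite addrA subrK; lra.
have upto i : (i <= n)%N -> forall u v, 0 <= u -> u <= v -> v <= t i ->
    `|derivenh m G v - derivenh m G u| <= g 0 * (v - u).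
  elim: i => [|i IH] im u v u0 uv.
    rewrite t0 => v0; have -> : v = u by lra.
    by rewrite !subrr normr0 mulr0.
  move=> vt; have [vti|tiv] := leP v (t i); first exact: IH (ltnW im) _ _ _ _ _.
  have [uti|tiu] := leP u (t i); last exact: (piece i) (ltnW im) (ltW tiu) _ _.
  apply: (glue (t i)) => //; first exact: ltW.
    exact: IH (ltnW im) _ _ _ _ _.
  exact: (piece i) (ltnW im) _ (ltW tiv) _.
move=> u v u0 uv.
have [vti|tiv] := leP v (t n); first exact: upto (leqnn _) _ _ _ _ _.
have [uti|tiu] := leP u (t n); last first.
  by apply: (piece n) => //; [exact: ltW | rewrite ltnn].
apply: (glue (t n)) => //; first exact: ltW.
  exact: upto (leqnn _) _ _ _ _ _.
by apply: (piece n) => //; [exact: ltW | rewrite ltnn].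
Qed.

(** Almost everywhere the derivative of [derivenh m G] translated by [T], taken
    with the sign of the piece, is [g (w - T) >= g w], which dominates that of
    [derivenh m x] because [g] is non-increasing. Translating [G] rather than
    [x] keeps the null set fixed. *)
Lemma spline_dominates m fm fp g x n G t eps T i u v :
  Wclass m.+1 fm fp g x -> spline_data m g n G t eps ->
  positive_halfline g -> nonincreasing_halfline g -> 0 <= T ->
  (i <= n)%N -> t i <= u -> u < v -> ((i < n)%N -> v <= t i.+1) ->
  eps * (-1) ^+ i * (derivenh m x (v + T) - derivenh m x (u + T)) <=
  eps * (-1) ^+ i * (derivenh m G v - derivenh m G u).
Proof.
move=> Wx sG g0 gni T0 im tu uv vt.
have [_ _ acx _ aex] := Wx.
have [_ t0 tS eps1 dG] := sG.
have u0 : 0 <= u by rewrite (le_trans _ tu)// (knot_ge0 t0 tS).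
set s := eps * (-1) ^+ i.
have s1 : `|s| = 1 by exact: norm_sign.
have s2 : s * s = 1 by have := sign_sq i eps1; rewrite expr2.
pose phi w := s * (derivenh m G (w + - T) - derivenh m x w).
have acphi : abs_continuous (u + T) (v + T) phi.
  apply: (@ac_perturb _ _ (derivenh m x) _ (g 0)).
  - have vT0 : 0 <= v + T by lra.
    move=> e /(acx _ vT0)[d d0 Hd]; exists d => // N a b Hab.
    apply: Hd => // j; have [? ? ?] := Hab j; split => //; lra.
  - by rewrite ltW// g0.
  - move=> a b ua ab bv; rewrite /phi -mulrBr normrM s1 mul1r.
    have aT : 0 <= a + - T by lra.
    have abT : a + - T <= b + - T by lra.
    have := spline_lipschitz sG g0 gni aT abT.
    have := ler_normB (derivenh m G (b + - T) - derivenh m G (a + - T))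
      (derivenh m x b - derivenh m x a).
    rewrite (_ : b + - T - (a + - T) = b - a); last by ring.
    rewrite (_ : derivenh m G (b - T) - derivenh m x b -
       (derivenh m G (a - T) - derivenh m x a) =
       derivenh m G (b - T) - derivenh m G (a - T) -
       (derivenh m x b - derivenh m x a)); last by ring.
    lra.
have : phi (u + T) <= phi (v + T).
  apply: (ac_nondecreasing _ acphi aex); first by lra.
  move=> w /andP[uw wv] /contrapT Hw.
  have w0 : 0 < w by lra.
  have [dx xg] := Hw (ltW w0).
  have dxw := derivableh_is_derive w0 dx.
  have dGw : is_derive w 1 (fun w => derivenh m G (w + - T)) (s * g (w + - T)).
    apply: is_derive_translate; apply: dG => //; first by lra.
    by move=> /vt; lra.
  exists (s * (s * g (w + - T) - deriveh (derivenh m x) w)).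
    have := ler_norm (s * deriveh (derivenh m x) w).
    rewrite normrM s1 mul1r mulrBr mulrA s2 mul1r.
    have : g w <= g (w + - T) by apply: gni; lra.
    move: xg; rewrite /derivenh iterS -/(derivenh m x); lra.
  exact: (is_deriveZ s (is_deriveB dGw dxw)).
rewrite /phi !addrK; lra.
Qed.

End Splines.

(** * Comparison with an oscillating spline *)

Section Comparison.
Context {R : realType}.
Implicit Types (f g x G fm fp : R -> R) (t p : nat -> R) (c s : R) (m n j k : nat).

Lemma is_derive_eventually_const f (u q l K : R) : q < u ->
  (forall v, q < v -> f v = K) -> is_derive u 1 f l -> l = 0.
Proof.
move=> qu HK /is_derive_hquot H.
apply: (cvg_unique _ H) => //.
apply: cvg_near_cst; apply/nbhs_ballP; exists (u - q) => /=.
  by rewrite subr_gt0.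
move=> h; rewrite /ball/= sub0r normrN => /ltr_normlP[h1 h2] _.
by rewrite /hquot !HK ?subrr ?mulr0//; lra.
Qed.

Lemma chain_const_eq0 m (D : nat -> R -> R) q K : deriv_chain m D -> 0 <= q ->
  (forall u, q < u -> D 0%N u = K) ->
  forall j, (j < m)%N -> forall u, q < u -> D j.+1 u = 0.
Proof.
move=> [_ dD] q0 HK; elim=> [|j IH] jm u qu.
  exact: is_derive_eventually_const qu HK (dD _ jm _ (le_lt_trans q0 qu)).
apply: (is_derive_eventually_const qu (IH (ltnW jm))).
exact: dD jm _ (le_lt_trans q0 qu).
Qed.

(** What the comparison uses of the points of oscillation, for both orientations
    at once (the sign [c]). The maximality is also against points [u] to the
    right of [p i]: the obstacles are non-increasing, so that translates of an
    admissible function stay below the peak as well. *)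
Definition peaks fm fp c n G p : Prop :=
  [/\ 0 <= p 0%N, forall i, (i < n)%N -> p i < p i.+1,
      forall i, (i <= n)%N -> 0 < c * (-1) ^+ i * G (p i)
    & forall i, (i <= n)%N -> forall u y, p i <= u -> - fm u <= y <= fp u ->
        c * (-1) ^+ i * y <= c * (-1) ^+ i * G (p i)].

Lemma spline_alternately_monotone m g n G t eps : spline_data m g n G t eps ->
  positive_halfline g -> alternately_monotone (derivenh m G) t n eps.
Proof.
move=> sG g0 i im u v tu uv vt.
have [w /andP[uw wv] ->] := spline_MVT sG im tu uv vt.
have [_ t0 tS eps1 _] := sG.
have w0 : 0 <= w.
  by rewrite (le_trans _ (ltW uw))// (le_trans _ tu)// (knot_ge0 t0 tS).
have := sign_sq i eps1; set s := eps * _; rewrite expr2 => ss1.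
rewrite 2!mulrA ss1 mul1r.
by rewrite mulr_gt0 ?subr_gt0// g0.
Qed.

Lemma peaks_ge0 fm fp c n G p : peaks fm fp c n G p ->
  forall i, (i <= n)%N -> 0 <= p i.
Proof.
by move=> [p0 pS _ _] i im; rewrite (le_trans p0)// (le_incr_nat pS).
Qed.

(** Beyond the last peak [G] cannot exceed it, and cannot remain equal to it
    since the [m]-th derivative of a spline is not eventually zero. The descent
    supplies an [n.+1]-st alternation of [G'], and [no_alternation] excludes the
    opposite sign. *)
Lemma spline_sign m g n G t eps fm fp c p B :
  spline_data m g n G t eps -> positive_halfline g -> (0 < m)%N ->
  (forall u, 0 <= u -> - fm u <= G u <= fp u) ->
  (forall u, 0 <= u -> `|G u| <= B) ->
  c = 1 \/ c = -1 -> peaks fm fp c n G p ->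
  eps = c * (-1) ^+ m.+1.
Proof.
move=> sG g0 m0 bG BG c1 pk.
have pn0 := peaks_ge0 pk (leqnn n).
have [p0 pS pG pmax] := pk.
have [cG t0 tS eps1 _] := sG.
have mG := spline_alternately_monotone sG g0.
apply: contrapT => epsN.
have epsE : eps = c * (-1) ^+ m.
  move: epsN; rewrite exprS -signr_odd; case: (odd m); rewrite ?expr1 ?expr0.
    by case: c1 eps1 => -> [] ->; lra.
  by case: c1 eps1 => -> [] ->; lra.
have [q pq Gq] : exists2 q, p n < q & c * (-1) ^+ n * G q < c * (-1) ^+ n * G (p n).
  apply: contrapT => H.
  have Gcst u : p n < u -> G u = G (p n).
    move=> pu; have u0 : 0 <= u by rewrite (le_trans pn0)// ltW.
    have le1 := pmax n (leqnn _) u (G u) (ltW pu) (bG u u0).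
    have le2 : c * (-1) ^+ n * G (p n) <= c * (-1) ^+ n * G u.
      by rewrite leNgt; apply/negP => ?; apply: H; exists u.
    have : c * (-1) ^+ n * G u = c * (-1) ^+ n * G (p n).
      by apply/eqP; rewrite eq_le le1 le2.
    have /mulfI : c * (-1) ^+ n != 0.
      by rewrite -normr_eq0 norm_sign// oner_eq0.
    by apply.
  have := chain_const_eq0 cG pn0 Gcst (_ : m.-1 < m)%N.
  rewrite prednK// leqnn => /(_ isT) Gm0.
  pose a := maxr (t n) (p n + 1).
  have ta : t n <= a by rewrite le_max lexx.
  have pa : p n < a by rewrite /a lt_max; apply/orP; right; lra.
  have := mG n (leqnn _) a (a + 1) ta.
  rewrite ltnn !Gm0//; [|lra].
  by rewrite subrr mulr0 ltxx => H1; have : false by apply: H1 => //; lra.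
have zz : zigzags G (- c) n.+1 by exact: (zigzags_extend p0 pS pG pq Gq).
have aG1 := zigzags_deriv cG m0 zz.
apply: (no_alternation cG BG _ t0 mG _ aG1); first by rewrite m0.
rewrite epsE -mulrA -exprD; case: (m) m0 => // m' _.
by rewrite subn1/= addSn -signr_odd/= oddD addbb expr1; ring.
Qed.

(** The class weights [wm], [wp] are kept apart from the obstacles [fm], [fp],
    which carry the factor [delta]. *)
Lemma comparison m wm wp fm fp g x n G t eps c p T k b :
  Wclass m.+1 wm wp g x -> (forall u, 0 <= u -> - fm u <= x u <= fp u) ->
  spline_data m g n G t eps -> (forall u, 0 <= u -> - fm u <= G u <= fp u) ->
  positive_halfline g -> nonincreasing_halfline g ->
  (forall u, 0 <= u -> fm u <= b /\ fp u <= b) ->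
  c = 1 \/ c = -1 -> peaks fm fp c n G p ->
  0 <= T -> (0 < k <= m)%N ->
  c * (-1) ^+ k * derivenh k x T <= `|derivenh k G 0|.
Proof.
move=> Wx bx sG bG g0 gni fb c1 pk T0 km.
have bnd y u : 0 <= u -> - fm u <= y <= fp u -> `|y| <= b.
  by move=> u0 /andP[? ?]; have [? ?] := fb u u0; rewrite ler_norml; lra.
have m0 : (0 < m)%N by case/andP: km => k0; exact: leq_trans.
have epsE : eps = c * (-1) ^+ m.+1.
  by apply: (spline_sign sG g0 m0 bG _ c1 pk) => u u0; exact: bnd (bG u u0).
rewrite leNgt; apply/negP; set V := c * _ * _ => GV.
have V0 : 0 < V by exact: le_lt_trans GV.
(* The factor [l < 1] leaves room in both strict inequalities: at the peaks,
   and for the monotonicity of [D m]; midway between the two sides of [GV]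
   it still leaves [D k 0] with the opposite sign. *)
have [l [l0 l1 lV]] : exists l, [/\ 0 <= l, l < 1 & `|derivenh k G 0| < l * V].
  have A0 := normr_ge0 (derivenh k G 0).
  exists ((`|derivenh k G 0| + V) / 2 / V).
  rewrite divfK ?gt_eqF// ltr_pdivrMr// mul1r; split; last by lra.
  - by rewrite !divr_ge0 ?addr_ge0// ltW.
  - by lra.
pose D j u := derivenh j G u - l * derivenh j x (u + T).
have [cG t0 tS eps1 _] := sG.
have cD : deriv_chain m D.
  apply: chain_lin => //; apply: (@chain_translate _ _ (fun j => derivenh j x)) => //.
  exact: Wclass_chain Wx.
have BD u : 0 <= u -> `|D 0%N u| <= b + b.
  move=> u0; have uT : 0 <= u + T by exact: addr_ge0.
  rewrite (le_trans (ler_normB _ _))// lerD//; first exact: bnd (bG u u0).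
  rewrite normrM ger0_norm//.
  have := bnd _ _ uT (bx _ uT); rewrite /derivenh /=.
  have : l * `|x (u + T)| <= 1 * `|x (u + T)| by rewrite ler_wpM2r// ltW.
  lra.
have mD : alternately_monotone (D m) t n eps.
  move=> i im u v tu uv vt.
  have := spline_alternately_monotone sG g0 im tu uv vt.
  have := spline_dominates Wx sG g0 gni T0 im tu uv vt.
  rewrite /D; set s := eps * _; set dX := _ - derivenh m x _.
  set dG := _ - derivenh m G _ => le1 gt0.
  have : l * (s * dX) <= l * (s * dG) by rewrite ler_wpM2l.
  have : l * (s * dG) < 1 * (s * dG) by rewrite ltr_pM2r.
  rewrite /dX /dG; lra.
have [p0 pS pG pmax] := pk.
have aD0 : alternates (D 0%N) c n.+1.
  exists p; split=> // i; rewrite ltnS => im; have pi0 := peaks_ge0 pk im.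
  have piT : 0 <= p i + T by exact: addr_ge0.
  have le1 : p i <= p i + T by lra.
  have := pmax i im _ _ le1 (bx _ piT); have := pG i im.
  rewrite /D /derivenh /=; set s := c * _; set sG' := s * _ => gt0 le2.
  have : l * (s * x (p i + T)) <= l * sG' by rewrite ler_wpM2l.
  have : l * sG' < 1 * sG' by rewrite ltr_pM2r.
  rewrite /sG'; lra.
have aD1 := zigzags_deriv cD m0 (alternates_zigzags aD0).
have /andP[k0 km'] := km.
have aDk : alternates (D k) (c * (-1) ^+ k) n.
  have := alternates_up cD BD (ltnSn 0) (_ : 1 + k.-1 <= m)%N aD1.
  rewrite add1n prednK// => /(_ km'); rewrite -{4}(prednK k0) exprS; congr alternates; ring.
have aDk' : alternates (D k) (- (c * (-1) ^+ k)) n.+1.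
  apply: (alternates_prepend aDk); rewrite /D add0r.
  have : c * (-1) ^+ k * derivenh k G 0 <= `|derivenh k G 0|.
    by rewrite (le_trans (ler_norm _))// normrM norm_sign// mul1r.
  move: lV; rewrite /V; lra.
apply: (no_alternation cD BD km t0 mD _ aDk').
rewrite epsE exprS -{1}(subnK km') exprD mulN1r.
have := sqrr_sign R (m - k)%N; rewrite expr2.
set e := (-1) ^+ (m - k); set e' := (-1) ^+ k => ee.
by rewrite -[LHS]mulr1 -ee; ring.
Qed.

End Comparison.

(** * The modulus of continuity *)

Section Extremal.
Context {R : realType}.
Implicit Types (f g x G fm fp : R -> R) (t p : nat -> R) (c s : R) (m n j k : nat).
Notation mu := (@lebesgue_measure R).

Lemma wnorm_leP fm fp x (delta : R) :
  positive_halfline fm -> positive_halfline fp -> 0 <= delta ->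
  (wnorm fm fp x <= delta%:E)%E <->
  (forall u, 0 <= u -> - (delta * fm u) <= x u <= delta * fp u).
Proof.
move=> fm0 fp0 d0.
have H u : 0 <= u -> 
   (`|Num.max (x u) 0 / fp u + Num.max (- x u) 0 / fm u| <= delta) <->
   - (delta * fm u) <= x u <= delta * fp u.
  move=> u0; have fmu := fm0 u u0; have fpu := fp0 u u0.
  have dm : 0 <= delta * fm u by rewrite mulr_ge0// ltW.
  have dp : 0 <= delta * fp u by rewrite mulr_ge0// ltW.
  have [x0|/ltW x0] := leP 0 (x u).
    rewrite (max_idPr _) ?oppr_le0// mul0r addr0.
    rewrite ger0_norm ?divr_ge0 ?(ltW fpu)// ler_pdivrMr//.
    by split=> [->|/andP[]//]; rewrite andbT (le_trans _ x0)// oppr_le0.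
  rewrite (max_idPl _) ?oppr_ge0// mul0r add0r.
  rewrite ger0_norm ?divr_ge0 ?oppr_ge0 ?(ltW fmu)// ler_pdivrMr// lerNl.
  by split=> [->|/andP[]//]; rewrite (le_trans x0).
split=> [W u u0|W].
  apply/H => //; rewrite -lee_fin; apply: le_trans W; apply: ereal_sup_ubound.
  by exists u => //; rewrite /halfline /= in_itv/= u0.
apply: ge_ereal_sup => _ [u + <-]; rewrite /halfline /= in_itv/= andbT => u0.
by rewrite lee_fin; apply/H => //; exact: W.
Qed.

(** Off the countable set of values of [t], every point lies inside one of the
    intervals between knots, where the derivative is known. *)
Lemma spline_Wball m fm fp g n G t eps (delta : R) :
  spline_data m g n G t eps -> nderivableh m G ->
  positive_halfline g -> nonincreasing_halfline g ->
  (wnorm fm fp G <= delta%:E)%E -> Wball m.+1 fm fp g delta G.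
Proof.
move=> sG dG g0 gni WG; split => //.
have [[cG _] t0 tS eps1 dGm] := sG.
split=> //.
- exact: (cG 0%N).
- apply: (lipschitz_loc_ac _ (spline_lipschitz sG g0 gni)).
  by rewrite ltW// g0.
- exact: le_lt_trans WG (ltry _).
have nN : mu.-negligible (\bigcup_i [set t i]).
  apply: negligible_bigcup => i; apply/negligibleP => //.
  exact: lebesgue_measure_set1.
apply: negligibleS nN => u /= H; apply: contrapT => tu; apply: H => u0.
have {}tu i : t i != u by apply/eqP => E; apply: tu; exists i.
have [i [im tiu utS]] : exists i, [/\ (i <= n)%N, t i < u &
    ((i < n)%N -> u < t i.+1)].
  have main j : (j <= n)%N -> t j < u \/ exists i, [/\ (i < j)%N, t i < u & u < t i.+1].
    elim: j => [_|j IH jn].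
      by left; rewrite lt_neqAle tu t0 u0.
    have [tju|[i [ij h1 h2]]] := IH (ltnW jn); last first.
      by right; exists i; split => //; exact: ltnW.
    have [utj|tju'] := ltP u (t j.+1); first by right; exists j.
    by left; rewrite lt_neqAle tu.
  have [tnu|[i [ij h1 h2]]] := main n (leqnn _).
    by exists n; split; rewrite ?ltnn.
  by exists i; split => //; exact: ltnW.
have du := dGm i im u tiu utS.
have u1 : 0 < u by exact: le_lt_trans (knot_ge0 t0 tS im) tiu.
have dh : derivableh (derivenh m G) u.
  rewrite /derivableh hfilter_pos//; apply/cvg_ex.
  by exists (eps * (-1) ^+ i * g u); apply/is_derive_hquot.
split => //.
have := derivableh_is_derive u1 dh => -[_ E].
have [_ E'] := du.
rewrite -E E' normrM norm_sign// mul1r.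
by rewrite gtr0_norm// g0.
Qed.

Lemma oscillates_peaks (pos : bool) fm fp G n :
  positive_halfline fm -> positive_halfline fp ->
  nonincreasing_halfline fm -> nonincreasing_halfline fp ->
  oscillates pos n.+1 (fun u => - fm u) fp G ->
  exists p, peaks fm fp ((-1) ^+ (~~ pos)) n G p.
Proof.
move=> fm0 fp0 fmn fpn [bG [s [s0 sS sG]]]; exists (fun i => s i.+1).
have sp i : (i <= n)%N -> 0 <= s i.+1 by move=> im; exact: s0.
split=> [|i im|i im|i im u y su /andP[yl yu]]; rewrite ?sp// ?sS//.
- have := fm0 _ (sp i im); have := fp0 _ (sp i im).
  rewrite sG// /= -(signr_odd _ i); case: (pos); case: (odd i) => /=;
  by rewrite ?expr0 ?expr1 ?mulrN1 ?mulr1 ?mul1r ?mulN1r ?opprK; lra.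
- have fpu := fpn _ _ (sp i im) su; have fmu := fmn _ _ (sp i im) su.
  rewrite sG// /= -(signr_odd _ i); case: (pos); case: (odd i) => /=;
  by rewrite ?expr0 ?expr1 ?mulrN1 ?mulr1 ?mul1r ?mulN1r ?opprK; lra.
Qed.

Lemma threshold_index (a : nat -> \bar R) (delta : R) : threshold_seq a -> 0 < delta ->
  exists n, (a n.+1 <= delta%:E < a n)%E.
Proof.
move=> [a0 apos _ alim] d0.
have ex : exists n, (a n <= delta%:E)%E.
  have : \forall n \near \oo, (a n < delta%:E)%E.
    apply: (alim [set x | (x < delta%:E)%E]); apply: open_nbhs_nbhs; split.
      exact: open_ereal_lt_ereal.
    by rewrite /= lte_fin.
  by move=> [N _ HN]; exists N; exact/ltW/HN/leqnn.
case: (ex_minnP ex) => -[|n] an amin; first by move: an; rewrite a0 leye_eq.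
by exists n; rewrite an ltNge; apply/negP => /amin; rewrite ltnn.
Qed.

(** [T] is arbitrary, so this bounds the whole derivative [derivenh k x] on one
    side; the other side comes from the opposite orientation. *)
Lemma derivative_bound (pos : bool) m fm fp g (a : nat -> \bar R) (G : R -> R -> R)
    (delta : R) : (0 < m)%N -> 0 < delta ->
  positive_halfline g -> nonincreasing_halfline g ->
  positive_halfline fm -> nonincreasing_halfline fm ->
  positive_halfline fp -> nonincreasing_halfline fp ->
  threshold_seq a -> oscillating_family pos m.+1 fm fp g a G ->
  Wball m.+1 fm fp g delta (G delta) /\
  forall x k T, Wball m.+1 fm fp g delta x -> (0 < k <= m)%N -> 0 <= T ->
    (-1) ^+ (~~ pos) * (-1) ^+ k * derivenh k x T <= `|derivenh k (G delta) 0|.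
Proof.
move=> m0 d0 g0 gni fm0 fmn fp0 fpn ta osc.
have [n an] := threshold_index ta d0.
have [_ pG oG] := osc n delta an.
have [t [eps sG]] := gspline_data pG.
have [bG _] := oG.
have [[dG _] _] := pG.
have scale0 f : positive_halfline f -> positive_halfline (fun u => delta * f u).
  by move=> f0 u u0; rewrite mulr_gt0// f0.
have scalen f : nonincreasing_halfline f ->
    nonincreasing_halfline (fun u => delta * f u).
  by move=> fn u v u0 uv; rewrite ler_pM2l// fn.
have [p pk] := oscillates_peaks (scale0 _ fm0) (scale0 _ fp0) (scalen _ fmn)
  (scalen _ fpn) oG.
split.
  apply: (spline_Wball sG) => //.
  by apply/wnorm_leP => //; exact: ltW.
move=> x k T [Wx nx] km T0.
move: nx => /(wnorm_leP x fm0 fp0 (ltW d0)) bx.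
have c1 : (-1) ^+ (~~ pos) = 1 :> R \/ (-1) ^+ (~~ pos) = -1 :> R.
  by case: (pos); [left; rewrite expr0|right; rewrite expr1].
apply: (comparison (fm := fun u => delta * fm u) (fp := fun u => delta * fp u)
  (b := delta * fm 0 + delta * fp 0) Wx bx sG bG g0 gni _ c1 pk T0 km) => u u0.
have := scalen _ fmn _ _ (lexx 0) u0; have := scalen _ fpn _ _ (lexx 0) u0.
have := scale0 _ fm0 _ (lexx 0); have := scale0 _ fp0 _ (lexx 0).
by move=> ? ? ? ?; split; lra.
Qed.

End Extremal.

Theorem theorem4 (R : realType) (r : nat) (g fm fp : R -> R)
    (am ap : nat -> \bar R) (Gm Gp : R -> R -> R)
    (hr : (2 <= r)%N)
    (hg : assumption1 r g)
    (hfm : assumption2 fm) (hfp : assumption2 fp)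
    (hPm : assumption3 r g fm) (hPp : assumption3 r g fp)
    (ham : threshold_seq am) (hap : threshold_seq ap)
    (hGp : oscillating_family true r fm fp g ap Gp)
    (hGm : oscillating_family false r fm fp g am Gm) :
  forall (k : nat) (delta : R), (1 <= k <= r - 1)%N -> 0 < delta ->
    [/\ omega r fm fp g k delta =
          (Num.max `|derivenh k (Gp delta) 0| `|derivenh k (Gm delta) 0|)%:E,
        `|derivenh k (Gp delta) 0| > `|derivenh k (Gm delta) 0| ->
          omega_attained r fm fp g k delta (Gp delta)
      & ~ (`|derivenh k (Gp delta) 0| > `|derivenh k (Gm delta) 0|) ->
          omega_attained r fm fp g k delta (Gm delta)].
Proof.
case: r => [//|m] in hr hg hPm hPp hGp hGm *.
move=> k delta; rewrite subn1 /= => km d0.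
have [_ g0 gni _] := hg; have [_ fmn fm0 _] := hfm; have [_ fpn fp0 _] := hfp.
have [Wp Hp] := derivative_bound hr d0 g0 gni fm0 fmn fp0 fpn hap hGp.
have [Wm Hm] := derivative_bound hr d0 g0 gni fm0 fmn fp0 fpn ham hGm.
set Mp := `|derivenh k (Gp delta) 0| in Hp *.
set Mm := `|derivenh k (Gm delta) 0| in Hm *.
have sup_ge x : (`|derivenh k x 0|%:E <= supnorm (derivenh k x))%E.
  by apply: ereal_sup_ubound; exists 0 => //; rewrite /halfline /= in_itv/= lexx.
have sup_le x : Wball m.+1 fm fp g delta x ->
    (supnorm (derivenh k x) <= (Num.max Mp Mm)%:E)%E.
  move=> Wx; apply: ge_ereal_sup => _ [u + <-].
  rewrite /halfline /= in_itv/= andbT lee_fin => u0.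
  have := Hp x k u Wx km u0; have := Hm x k u Wx km u0.
  rewrite -/Mm -/Mp expr0 expr1 mul1r mulN1r mulNr -(signr_odd _ k) => hm hp.
  rewrite ler_norml lerNl !le_max; case: (odd k) hm hp;
    rewrite ?expr1 ?expr0 ?mul1r ?mulN1r ?opprK => -> ->;
    by rewrite ?orbT.
have omega_ge x : Wball m.+1 fm fp g delta x ->
    (supnorm (derivenh k x) <= omega m.+1 fm fp g k delta)%E.
  by move=> Wx; apply: ereal_sup_ubound; exists x.
have omegaE : omega m.+1 fm fp g k delta = (Num.max Mp Mm)%:E.
  apply/eqP; rewrite eq_le; apply/andP; split.
    by apply: ge_ereal_sup => _ [x Wx <-]; exact: sup_le.
  have [_|_] := leP Mp Mm.
    by apply: le_trans (omega_ge _ Wm); exact: sup_ge.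
  by apply: le_trans (omega_ge _ Wp); exact: sup_ge.
split=> // [lt|/negP]; rewrite /omega_attained omegaE.
  split=> //; apply/eqP; rewrite eq_le sup_le//=.
  by rewrite (max_idPl (ltW lt)) sup_ge.
rewrite -leNgt => le; split=> //; apply/eqP; rewrite eq_le sup_le//=.
by rewrite (max_idPr le) sup_ge.
Qed.
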